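(* Let $d$ be a positive integer. Then $$\mathcal{PI}_{d,d}(z)=\sum_{0\le k\le d/2}\varphi_{d-2k}\bigl((1-z^2)A_k(z)\bigr)+\sum_{0\le k\le d/2}\Bigl(z\,\varphi_{d-2k}\bigl((1-z^2)B_k(z)\bigr)\Bigr)'_z,$$ where $$A_k(z)=-\frac{1}{z^{2k}}\lim_{t\to z^{-2k}}\frac{\partial}{\partial t}\Bigl(f_{d,d}(tz^d,z)(1-tz^{2k})^2\Bigr),\qquad B_k(z)=\lim_{t\to z^{-2k}}\Bigl(f_{d,d}(tz^d,z)(1-tz^{2k})^2\Bigr),$$ and $f_{d,d}(tz^d,z)=\prod_{j=0}^{d}(1-tz^{2j})^{-2}$.
   Context: All vector spaces are over $\mathbb{C}$. $V_d=\langle v_0,\dots,v_d\rangle$ is the $(d+1)$-dimensional irreducible $\mathfrak{sl}_2$-module with $D_1(v_i)=i\,v_{i-1}$, $D_2(v_i)=(d-i)v_{i+1}$ the actions of $\begin{pmatrix}0&1\\0&0\end{pmatrix}$ and $\begin{pmatrix}0&0\\1&0\end{pmatrix}$, extended by derivations to the symmetric algebra $S(V_{d}\oplus V_{d})$. The algebra of joint invariants is $\mathcal{I}_{d,d}=\{v\in S(V_{d}\oplus V_{d}) : D_1(v)=D_2(v)=0\}$, graded by degree, and its Poincaré series is $\mathcal{PI}_{d,d}(z)=\sum_{n\ge0}\dim\bigl((\mathcal{I}_{d,d})_n\bigr)z^n$. $f_{d,d}(t,z)=\prod_{j=0}^{d}(1-tz^{d-2j})^{-2}$. For an integer $n\ge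 0$, $\varphi_n:\mathbb{C}[[z]]\to\mathbb{C}[[z]]$ is the linear map $\varphi_n\bigl(\sum_{i\ge0}a_iz^i\bigr)=\sum_{i\ge0}a_{in}z^i$ (so $\varphi_0(\sum a_iz^i)=a_0\sum_{i\ge 0} z^i$). $(\cdot)'_z$ is the derivative in $z$. The limits are evaluations in the field of rational functions: after cancelling the factors vanishing at the given value of $t$, substitute this value; the resulting rational functions of $z$ are regular at $z=0$ and are identified with their power series at $z=0$. *)

(* Defs.v *)
From HB Require Import structures.
From mathcomp Require Import all_boot all_order all_algebra.
From mathcomp Require Import generic_quotient mpoly complex.
From mathcomp Require Import reals.

Set Implicit Arguments.
Unset Strict Implicit.
Unset Printing Implicit Defensive.

Import GRing.Theory.

Local Open Scope ring_scope.

Section JointInvariants.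

Variables (C : fieldType) (d : nat).

(* The symmetric algebra S(V_d (+) V_d), as the polynomial ring on the basis
   v_0, ..., v_d (first copy of V_d), w_0, ..., w_d (second copy). *)
Local Notation SVV := {mpoly C[d.+1 + d.+1]}.

Definition vvar (i : 'I_d.+1) : SVV := 'X_(lshift d.+1 i).
Definition wvar (i : 'I_d.+1) : SVV := 'X_(rshift d.+1 i).

(* The derivation of S(V_d (+) V_d) with v_i |-> a i and w_i |-> b i. *)
Definition deriv_ext (a b : 'I_d.+1 -> SVV) (p : SVV) : SVV :=
  \sum_(i < d.+1) a i * p^`M(lshift d.+1 i) +
  \sum_(i < d.+1) b i * p^`M(rshift d.+1 i).

(* inord i.-1 (i = 0) and inord i.+1 (i = d) are out of range, but then they
   come with a zero coefficient. *)
Definition D1 : SVV -> SVV :=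
  deriv_ext (fun i => i%:R *: vvar (inord i.-1))
            (fun i => i%:R *: wvar (inord i.-1)).

Definition D2 : SVV -> SVV :=
  deriv_ext (fun i => (d - i)%:R *: vvar (inord i.+1))
            (fun i => (d - i)%:R *: wvar (inord i.+1)).

Lemma deriv_extM a b p q :
  deriv_ext a b (p * q) = deriv_ext a b p * q + p * deriv_ext a b q.
Proof.
rewrite /deriv_ext mulrDl mulrDr addrACA !mulr_suml !mulr_sumr.
by congr (_ + _); rewrite -big_split /=; apply: eq_bigr => i _;
  rewrite mderivM mulrDr !mulrA (mulrC p).
Qed.

Lemma mderivU (i j : 'I_(d.+1 + d.+1)) : ('X_j : SVV)^`M(i) = (j == i)%:R.
Proof.
rewrite mderivX mnm1E; case: eqP => [->|_]; last by rewrite scale0r.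
by rewrite scale1r -{1}[U_(i)%MM]add0m addmK mpolyX0.
Qed.

Lemma deriv_ext_v a b i : deriv_ext a b (vvar i) = a i.
Proof.
rewrite /deriv_ext /vvar (bigD1 i) //= !big1 ?addr0 => [|j _|j ji].
- by rewrite mderivU eqxx mulr1.
- by rewrite mderivU eq_lrshift mulr0.
- by rewrite mderivU (inj_eq (@lshift_inj _ _)) eq_sym (negbTE ji) mulr0.
Qed.

Lemma deriv_ext_w a b i : deriv_ext a b (wvar i) = b i.
Proof.
rewrite /deriv_ext /wvar addrC (bigD1 i) //= !big1 ?addr0 => [|j _|j ji].
- by rewrite mderivU eqxx mulr1.
- by rewrite mderivU eq_rlshift mulr0.
- by rewrite mderivU (inj_eq (@rshift_inj _ _)) eq_sym (negbTE ji) mulr0.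
Qed.

Lemma deriv_ext_is_linear a b : linear (deriv_ext a b).
Proof.
move=> c p q; rewrite /deriv_ext scalerDr addrACA !scaler_sumr.
by congr (_ + _); rewrite -big_split /=; apply: eq_bigr => i _;
  rewrite linearP /= mulrDr scalerAr.
Qed.

Lemma mulX_mderiv_homog n (i j : 'I_(d.+1 + d.+1)) (p : SVV) :
  p \is n.-homog -> 'X_j * p^`M(i) \is n.-homog.
Proof.
move=> /dhomogP hp; rewrite [p]mpolyE raddf_sum /= mulr_sumr big_seq.
apply: rpred_sum => m /hp hm; rewrite linearZ /= -scalerAr mderivX.
have [->|mi] := eqVneq (m i) 0%N; first by rewrite scale0r mulr0 scaler0 rpred0.
rewrite -scalerAr !rpredZ // -mpolyXD dhomogX /= mdegD mdeg1.
have Ui : (U_(i) <= m)%MM by rewrite lep1mP.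
by rewrite -hm /= -{2}(submK Ui) mdegD mdeg1 addnC.
Qed.

Lemma D1_homog n p : p \is n.-homog -> D1 p \is n.-homog.
Proof.
move=> hp; apply: rpredD; apply: rpred_sum => i _;
  by rewrite -scalerAl rpredZ // mulX_mderiv_homog.
Qed.

Lemma D2_homog n p : p \is n.-homog -> D2 p \is n.-homog.
Proof.
move=> hp; apply: rpredD; apply: rpred_sum => i _;
  by rewrite -scalerAl rpredZ // mulX_mderiv_homog.
Qed.

Definition joint_invariant (p : SVV) : Prop := D1 p = 0 /\ D2 p = 0.

Section Graded.

Variable n : nat.

(* The library's vectType instance on homogeneous polynomials wants a number
   of variables in syntactic successor form. *)
Definition SVVn : vectType C := dhomog (d + d.+1).+1 C n.

Definition D1n (p : SVVn) : SVVn := DHomog (D1_homog (dhomog_is_dhomog p)).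
Definition D2n (p : SVVn) : SVVn := DHomog (D2_homog (dhomog_is_dhomog p)).

Lemma D1n_is_linear : linear D1n.
Proof. by move=> c p q; apply/val_inj/deriv_ext_is_linear. Qed.

Lemma D2n_is_linear : linear D2n.
Proof. by move=> c p q; apply/val_inj/deriv_ext_is_linear. Qed.

HB.instance Definition _ := GRing.isLinear.Build C SVVn SVVn _ D1n D1n_is_linear.
HB.instance Definition _ := GRing.isLinear.Build C SVVn SVVn _ D2n D2n_is_linear.

Definition invariants : {vspace SVVn} :=
  (lker (linfun D1n) :&: lker (linfun D2n))%VS.

Lemma mem_invariants (p : SVVn) :
  reflect (joint_invariant (mpoly_of_dhomog p)) (p \in invariants).
Proof.
rewrite memv_cap !memv_ker !lfunE /=.
apply: (iffP andP) => [[/eqP h1 /eqP h2]|[h1 h2]].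
  by split; [exact: (congr1 val h1)|exact: (congr1 val h2)].
by split; apply/eqP/val_inj.
Qed.

End Graded.

End JointInvariants.

(* t and z range over an arbitrary field, so that t := t * z ^+ d is a literal
   substitution. *)
Definition f_dd (L : fieldType) (d : nat) (t z : L) : L :=
  \prod_(0 <= j < d.+1) (1 - t * z ^ (d%:Z - (2 * j)%:Z)) ^- 2.

Section RationalFunctions.

Variable K : fieldType.

Local Notation ratfun := {fraction {poly K}}.
Local Notation "x %:F" := (@FracField.tofrac {poly K} x).

(* The value of r at a: cancel the common factors of numerator and denominator,
   then substitute a.  Meaningful when r has no pole at a; see rlim_frac. *)
Definition rlim (a : K) (r : ratfun) : K :=
  let p := \n_(repr r) in let q := \d_(repr r) in
  (p %/ gcdp p q).[a] / (q %/ gcdp p q).[a].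

Definition rderiv (r : ratfun) : ratfun :=
  let p := \n_(repr r) in let q := \d_(repr r) in
  (p^`() * q - p * q^`())%:F / (q ^+ 2)%:F.

(* Coefficients of the power series of r at 0, for K of characteristic 0 and r
   regular at 0. *)
Definition taylor (r : ratfun) : nat -> K :=
  fun n => rlim 0 (iter n rderiv r) / n`!%:R.

Lemma ratfun_repr (r : ratfun) : r = (\n_(repr r))%:F / (\d_(repr r))%:F.
Proof.
have d0 := denom_ratioP (repr r).
apply: (canRL (mulfK _)); first by rewrite tofrac_eq0.
rewrite -{1}[r]reprK; unlock FracField.tofrac.
rewrite -[LHS](FracField.pi_mul (repr r)); apply/eqmodP.
by rewrite /= FracField.equivfE /FracField.mulf !numden_Ratio ?mulr1 ?oner_eq0 //
  mulrC.
Qed.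

Lemma rlim_frac a p q : q.[a] != 0 -> rlim a (p%:F / q%:F) = p.[a] / q.[a].
Proof.
move=> qa; have q0 : q != 0 by apply: contraNneq qa => ->; rewrite horner0.
rewrite /rlim; set r := p%:F / q%:F.
have d0 := denom_ratioP (repr r).
set p1 := \n_(repr r) in d0 *; set q1 := \d_(repr r) in d0 *.
have E : p1 * q = p * q1.
  apply/eqP; rewrite -tofrac_eq !tofracM -eqr_div ?tofrac_eq0 //.
  by rewrite -ratfun_repr.
set g := gcdp p1 q1.
have g0 : g != 0 by rewrite gcdp_eq0 negb_and d0 orbT.
have Ep : p1 %/ g * g = p1 by rewrite divpK // dvdp_gcdl.
have Eq : q1 %/ g * g = q1 by rewrite divpK // dvdp_gcdr.
have E' : (p1 %/ g) * q = p * (q1 %/ g).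
  by apply: (mulIf g0); rewrite mulrAC Ep -mulrA Eq.
have cop : coprimep (q1 %/ g) (p1 %/ g).
  by rewrite coprimep_sym coprimep_div_gcd // d0 orbT.
have /dvdpP [h Eh] : q1 %/ g %| q.
  by rewrite -(Gauss_dvdpr _ cop) E' dvdp_mull.
have qa' : (q1 %/ g).[a] != 0.
  by apply: contraNneq qa => h0; rewrite Eh hornerM h0 mulr0.
by apply/eqP; rewrite eqr_div // -!hornerM E'.
Qed.

Lemma rderiv_frac p q : q != 0 ->
  rderiv (p%:F / q%:F) = (p^`() * q - p * q^`())%:F / (q ^+ 2)%:F.
Proof.
move=> q0; rewrite /rderiv; set r := p%:F / q%:F.
have d0 := denom_ratioP (repr r).
set p1 := \n_(repr r) in d0 *; set q1 := \d_(repr r) in d0 *.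
have E : p1 * q = p * q1.
  apply/eqP; rewrite -tofrac_eq !tofracM -eqr_div ?tofrac_eq0 //.
  by rewrite -ratfun_repr.
have E' : p1^`() * q + p1 * q^`() = p^`() * q1 + p * q1^`().
  by rewrite -!derivM E.
apply/eqP; rewrite eqr_div ?tofrac_eq0 ?expf_neq0 // -!tofracM tofrac_eq.
have -> : (p1^`() * q1 - p1 * q1^`()) * q ^+ 2 =
   (p1^`() * q) * q1 * q - (p1 * q) * q1^`() * q.
  rewrite mulrBl expr2 !mulrA; congr (_ - _); first by rewrite (mulrAC _ q1).
  by rewrite -!mulrA; congr (_ * _); rewrite mulrCA.
have -> : p1^`() * q = p^`() * q1 + p * q1^`() - p1 * q^`().
  by rewrite -E' addrK.
apply/eqP; rewrite !mulrDl !mulNr.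
have -> : p1 * q^`() * q1 * q = p * q1 * q^`() * q1.
  by rewrite -E -!mulrA; congr (_ * _); rewrite mulrA mulrC.
rewrite E addrAC -[p * q1 * q1^`()](mulrAC p) addrK expr2; congr (_ - _).
  by rewrite -!mulrA; congr (_ * _); rewrite mulrCA mulrA mulrC mulrA.
by rewrite -!mulrA; congr (_ * _); rewrite mulrCA.
Qed.

End RationalFunctions.

Section PartialFractions.

Variables (C : fieldType) (d k : nat).

Local Notation Cz := {fraction {poly C}}.
Local Notation Czt := {fraction {poly Cz}}.

Definition zvar : Cz := FracField.tofrac 'X.
Definition tvar : Czt := FracField.tofrac 'X.
Definition Cz_to_Czt (c : Cz) : Czt := FracField.tofrac c%:P.

(* f_{d,d}(t z^d, z) (1 - t z^(2k))^2 *)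
Definition G_k : Czt :=
  let z := Cz_to_Czt zvar in
  f_dd d (tvar * z ^+ d) z * (1 - tvar * z ^+ (2 * k)) ^+ 2.

Definition A_k : Cz :=
  - zvar ^- (2 * k) * rlim (zvar ^- (2 * k)) (rderiv G_k).

Definition B_k : Cz := rlim (zvar ^- (2 * k)) G_k.

End PartialFractions.

(* A formal power series is given by its sequence of coefficients. *)
Section PowerSeries.

Variable C : pzRingType.

Implicit Type a : nat -> C.

Definition phi (n : nat) a : nat -> C := fun i => a (i * n)%N.

Definition mulz a : nat -> C := fun i => if i is j.+1 then a j else 0.

Definition derivz a : nat -> C := fun i => a i.+1 *+ i.+1.

End PowerSeries.

Definition poincare (C : fieldType) (d : nat) : nat -> C :=
  fun n => (\dim (invariants C d n))%:R.

(* Main.v *)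
(* The operators D1, D2 and H = [D1, D2] form an sl2-triple acting on each
   graded piece, with H diagonal in the basis of monomials.  On a positive
   weight space all D1 D2 + c with c >= 0 are injective, so D1 maps weight 0
   onto weight 2, and the invariants are the kernel of D1 on weight 0 (the
   symmetric argument makes D1 injective on weight -2).  Hence dim (I_n) is the
   number of monomials of weight 0 minus the number of those of weight 2, i.e.
   the coefficient of z^(nd) in (1 - z^2) [t^n] f(t z^d, z).  Expanding
   f(t z^d, z) in partial fractions in t, this is the coefficient of z^(nd) in
   sum_k (1 - z^2) (A_k + (n + 1) B_k) z^(2kn); A_k and B_k are regular at
   z = 0, and vanish there for k > 0, so that only k <= d/2 contributes, even
   for n = 0. *)

Require Import Defs.
From mathcomp Require Import all_boot all_order all_algebra complex reals.
From mathcomp Require Import mpoly ring zify.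

Set Implicit Arguments.
Unset Strict Implicit.
Unset Printing Implicit Defensive.

Import Order.TTheory GRing.Theory Num.Theory.

Local Open Scope ring_scope.

(** * Weights and invariants *)

(* If [e (f x) = - c x] with [x] of weight [m], then [e x], of weight [m + 2],
   is killed by [e f + (m + c)]; so [e x = 0] by descending induction on [m],
   and [f (e x) = - (m + c) x] gives [x = 0]. *)
Lemma sl2_injective (K : numFieldType) (V : lmodType K)
    (e f : {linear V -> V}) (h : V -> V) (N : nat) :
  (forall x, e (f x) = f (e x) + h x) ->
  (forall x, h (e x) = e (h x) + 2%:R *: e x) ->
  (forall x m, (N < m)%N -> h x = m%:R *: x -> x = 0) ->
  forall (m c : nat) x, (0 < m)%N -> h x = m%:R *: x ->
    e (f x) + c%:R *: x = 0 -> x = 0.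
Proof.
move=> ef he bnd m.
have [k] := ubnP (N.+1 - m).
elim: k m => // k IHk m lek c x m_gt0 hx efx.
have [ltNm|lemN] := ltnP N m; first exact: bnd hx.
have fex : f (e x) + (m + c)%:R *: x = 0.
  by rewrite natrD scalerDl addrA -hx -ef.
have ex0 : e x = 0.
  apply: (IHk m.+2 _ (m + c)%N) => //.
  - by rewrite ltnS in lek; apply: leq_trans lek; rewrite ltn_sub2l.
  - by rewrite he hx linearZ -scalerDl -natrD addn2.
  - by rewrite -linearZ -linearD fex linear0.
move: fex; rewrite ex0 linear0 add0r => /eqP.
by rewrite scaler_eq0 pnatr_eq0 addn_eq0 eqn0Ngt m_gt0 => /eqP.
Qed.

(** The cross terms cancel: this is the Leibniz rule for the commutator of two derivations, with
    [dep] standing for [d (e p)] and so on. *)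
Lemma comm_derivationM (A : comPzRingType)
    (p q dp dq ep eq dep deq edp edq : A) :
  dep * q + ep * dq + (dp * eq + p * deq) -
    (edp * q + dp * eq + (ep * dq + p * edq)) =
  (dep - edp) * q + p * (deq - edq).
Proof. ring. Qed.

(** * The sl2-triple acting on polynomials *)

Section Representation.

Variables (C : numFieldType) (d : nat).

Local Notation N := (d.+1 + d.+1)%N.
Local Notation SVV := {mpoly C[N]}.

Definition vidx (i : 'I_N) : nat := match split i with inl j | inr j => j end.

Lemma vidx_lshift j : vidx (lshift d.+1 j) = j.
Proof. by rewrite /vidx -/(unsplit (inl j)) unsplitK. Qed.

Lemma vidx_rshift j : vidx (rshift d.+1 j) = j.
Proof. by rewrite /vidx -/(unsplit (inr j)) unsplitK. Qed.

(** Given by its eigenvalues on the variables, taken in [C] because they can be negative;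
    [comm_D1_D2] identifies it with the commutator. *)
Definition H : SVV -> SVV :=
  deriv_ext (fun i => (d%:R - (2 * i)%:R) *: vvar C i)
            (fun i => (d%:R - (2 * i)%:R) *: wvar C i).

(** By the Leibniz rule a derivation kills 1, so its values on the variables determine it on
    monomials, then everywhere by linearity. *)
Lemma derivation_ext (F G : SVV -> SVV) :
  linear F -> linear G ->
  (forall p q, F (p * q) = F p * q + p * F q) ->
  (forall p q, G (p * q) = G p * q + p * G q) ->
  (forall i, F (vvar C i) = G (vvar C i)) ->
  (forall i, F (wvar C i) = G (wvar C i)) -> F =1 G.
Proof.
move=> linF linG FM GM FGv FGw p.
have F1 (D : SVV -> SVV) :
    (forall p q, D (p * q) = D p * q + p * D q) -> D 1 = 0.
  move=> DM; apply: (addrI (D 1)); rewrite addr0.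
  by have := DM 1 1; rewrite !mulr1 mul1r => <-.
have F0 (D : SVV -> SVV) : linear D -> D 0 = 0.
  by move=> linD; have := linD (-1) 0 0; rewrite scaler0 addr0 scaleN1r addNr.
have FGX i : F 'X_i = G 'X_i.
  by rewrite -(splitK i); case: (split i) => j; [exact: FGv|exact: FGw].
have FGm m : F 'X_[m] = G 'X_[m].
  rewrite mpolyXE_id; apply: (big_ind (fun q => F q = G q)).
  - by rewrite !F1.
  - by move=> x y Ex Ey; rewrite FM GM Ex Ey.
  move=> i _; elim: (m i) => [|k IHk]; first by rewrite expr0 !F1.
  by rewrite exprS FM GM IHk FGX.
elim/mpolyind: p => [|c m q _ _ IHq]; first by rewrite !F0.
by rewrite linF linG FGm IHq.
Qed.

Lemma deriv_extD (a b : 'I_d.+1 -> SVV) p q :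
  deriv_ext a b (p + q) = deriv_ext a b p + deriv_ext a b q.
Proof. by have := deriv_ext_is_linear a b 1 p q; rewrite !scale1r. Qed.

Lemma deriv_ext0 (a b : 'I_d.+1 -> SVV) : deriv_ext a b 0 = 0.
Proof. by apply: (addrI (deriv_ext a b 0)); rewrite -deriv_extD !addr0. Qed.

Lemma deriv_extZ (a b : 'I_d.+1 -> SVV) c p :
  deriv_ext a b (c *: p) = c *: deriv_ext a b p.
Proof.
by have := deriv_ext_is_linear a b c p 0; rewrite deriv_ext0 !addr0.
Qed.

(** A commutator of derivations is a derivation, so it only has to be computed on the variables. *)
Lemma deriv_ext_comm (a b a' b' a'' b'' : 'I_d.+1 -> SVV) :
  (forall i, deriv_ext a b (a' i) - deriv_ext a' b' (a i) = a'' i) ->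
  (forall i, deriv_ext a b (b' i) - deriv_ext a' b' (b i) = b'' i) ->
  forall p, deriv_ext a b (deriv_ext a' b' p) -
            deriv_ext a' b' (deriv_ext a b p) = deriv_ext a'' b'' p.
Proof.
move=> Ea Eb; apply: derivation_ext.
- by move=> c p q; rewrite !deriv_ext_is_linear scalerBr opprD addrACA.
- exact: deriv_ext_is_linear.
- move=> p q; rewrite (deriv_extM a' b' p q) (deriv_extM a b p q).
  rewrite (deriv_extD a b (_ * _)) (deriv_extD a' b' (_ * _)).
  rewrite (deriv_extM a b _ q) (deriv_extM a b p).
  rewrite (deriv_extM a' b' _ q) (deriv_extM a' b' p).
  exact: comm_derivationM.
- move=> p q; exact: (deriv_extM a'' b'' p q).
- by move=> i; rewrite !deriv_ext_v.
- by move=> i; rewrite !deriv_ext_w.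
Qed.

(** On a variable of index [i] the commutator multiplies by
    [(d - i)(i + 1) - i(d - i + 1) = d - 2i]. *)
Lemma comm_D1_D2 (p : SVV) : D1 (D2 p) - D2 (D1 p) = H p.
Proof.
have E (x : 'I_d.+1 -> SVV) (i : 'I_d.+1) :
    (d - i)%:R *: ((inord i.+1 : 'I_d.+1)%:R *:
      x (inord (inord i.+1 : 'I_d.+1).-1)) -
    i%:R *: ((d - (inord i.-1 : 'I_d.+1))%:R *:
      x (inord (inord i.-1 : 'I_d.+1).+1)) =
    (d%:R - (2 * i)%:R) *: x i.
  have -> : i%:R *: ((d - (inord i.-1 : 'I_d.+1))%:R *:
      x (inord (inord i.-1 : 'I_d.+1).+1)) = (i * (d - i.-1))%:R *: x i.
    (* For [i = 0] the truncated predecessor gives a wrong index, but the factor [i] vanishes. *)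
    case: i => [[|i] lti] /=; first by rewrite mul0n !scale0r.
    rewrite scalerA -natrM inordK ?(ltnW lti) //; congr (_ *: x _).
    by apply: val_inj; rewrite /= inordK.
  have -> : (d - i)%:R *: ((inord i.+1 : 'I_d.+1)%:R *:
      x (inord (inord i.+1 : 'I_d.+1).-1)) = ((d - i) * i.+1)%:R *: x i.
    (* For [i = d] the argument of [inord] is out of range, but the factor [d - i] vanishes. *)
    have [ltid|leid] := ltnP i d; last first.
      by move: leid; rewrite -subn_eq0 => /eqP ->; rewrite mul0n !scale0r.
    by rewrite scalerA -natrM inordK //= inord_val.
  rewrite -scalerBl; congr (_ *: _); apply/eqP.
  rewrite subr_eq addrAC eq_sym subr_eq -!natrD eqr_nat; apply/eqP.
  by have := ltn_ord i; case: (nat_of_ord i) => [|j]; nia.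
apply: deriv_ext_comm => i; rewrite !deriv_extZ.
  by rewrite !deriv_ext_v E.
by rewrite !deriv_ext_w E.
Qed.

(** [D1] lowers the index by one, hence raises the weight [d - 2i] by two. *)
Lemma comm_H_D1 (p : SVV) : H (D1 p) - D1 (H p) = 2%:R *: D1 p.
Proof.
have E (x : 'I_d.+1 -> SVV) (i : 'I_d.+1) :
    i%:R *: ((d%:R - (2 * (inord i.-1 : 'I_d.+1))%:R) *: x (inord i.-1)) -
    (d%:R - (2 * i)%:R) *: (i%:R *: x (inord i.-1)) =
    2%:R *: (i%:R *: x (inord i.-1)).
  case: i => [[|i] lti] /=; first by rewrite !(scale0r, scaler0) subrr.
  rewrite inordK ?(ltnW lti) // !scalerA -scalerBl; congr (_ *: _).
  by rewrite !natrM -natr1; ring.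
(* [deriv_ext_comm] needs the right-hand side in the form of a single [deriv_ext]. *)
have E2 (q : SVV) : 2%:R *: D1 q = deriv_ext
    (fun i => 2%:R *: (i%:R *: vvar C (inord i.-1)))
    (fun i => 2%:R *: (i%:R *: wvar C (inord i.-1))) q.
  rewrite /D1 /deriv_ext scalerDr !scaler_sumr.
  by congr (_ + _); apply: eq_bigr => i _; rewrite -!scalerAl.
rewrite E2; apply: deriv_ext_comm => i; rewrite !deriv_extZ.
  by rewrite !deriv_ext_v E.
by rewrite !deriv_ext_w E.
Qed.

Lemma comm_D2_H (p : SVV) : D2 (H p) - H (D2 p) = 2%:R *: D2 p.
Proof.
have E (x : 'I_d.+1 -> SVV) (i : 'I_d.+1) :
    (d%:R - (2 * i)%:R) *: ((d - i)%:R *: x (inord i.+1)) -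
    (d - i)%:R *: ((d%:R - (2 * (inord i.+1 : 'I_d.+1))%:R) *: x (inord i.+1)) =
    2%:R *: ((d - i)%:R *: x (inord i.+1)).
  have [ltid|leid] := ltnP i d; last first.
    move: leid; rewrite -subn_eq0 => /eqP ->.
    by rewrite !(scale0r, scaler0) subrr.
  rewrite inordK // !scalerA -scalerBl; congr (_ *: _).
  by rewrite !natrM -natr1; ring.
have E2 (q : SVV) : 2%:R *: D2 q = deriv_ext
    (fun i => 2%:R *: ((d - i)%:R *: vvar C (inord i.+1)))
    (fun i => 2%:R *: ((d - i)%:R *: wvar C (inord i.+1))) q.
  rewrite /D2 /deriv_ext scalerDr !scaler_sumr.
  by congr (_ + _); apply: eq_bigr => i _; rewrite -!scalerAl.
rewrite E2; apply: deriv_ext_comm => i; rewrite !deriv_extZ.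
  by rewrite !deriv_ext_v E.
by rewrite !deriv_ext_w E.
Qed.

Definition mindex (m : 'X_{1..N}) : nat := (\sum_i vidx i * m i)%N.

(** Euler's relation: a variable times the partial derivative along it multiplies a monomial by the
    exponent of that variable. *)
Lemma H_mpolyX (m : 'X_{1..N}) :
  H 'X_[m] = (d%:R * (mdeg m)%:R - (2 * mindex m)%:R) *: 'X_[m] :> SVV.
Proof.
have E i : 'X_i * ('X_[m])^`M(i) = (m i)%:R *: 'X_[m] :> SVV.
  rewrite mderivX -scalerAr; have [->|mi] := eqVneq (m i) 0%N.
    by rewrite !scale0r.
  by rewrite -mpolyXD addmC submK // lep1mP.
transitivity (\sum_(i < N)
    (d%:R - (2 * vidx i)%:R) *: ((m i)%:R *: 'X_[m]) : SVV).
  rewrite big_split_ord /H /deriv_ext; congr (_ + _); apply: eq_bigr => i _.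
    by rewrite -scalerAl E vidx_lshift.
  by rewrite -scalerAl E vidx_rshift.
under eq_bigr do rewrite scalerA.
rewrite -scaler_suml; congr (_ *: _); rewrite mdegE /mindex.
rewrite big_distrr !natr_sum mulr_sumr -sumrB; apply: eq_bigr => i _.
by rewrite mulrBl !natrM mulrA.
Qed.

Lemma mcoeff_H (p : SVV) m :
  (H p)@_m = (d%:R * (mdeg m)%:R - (2 * mindex m)%:R) * p@_m.
Proof.
elim/mpolyind: p => [|c m' q _ _ IHq].
  by rewrite /H deriv_ext0 mcoeff0 mulr0.
rewrite {1}/H deriv_extD deriv_extZ -/(H _) H_mpolyX.
rewrite mcoeffD IHq mcoeffD !mcoeffZ mcoeffX.
have [->|_] := eqVneq m' m; first by rewrite mulrDr mulr1 mulrC mulr1.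
by rewrite !mulr0 !add0r.
Qed.

Lemma H_homog n p : p \is n.-homog -> H p \is n.-homog.
Proof.
move=> hp; apply: rpredD; apply: rpred_sum => i _;
  by rewrite -scalerAl rpredZ // mulX_mderiv_homog.
Qed.

End Representation.

(** * Weight spaces in a fixed degree *)

Section WeightSpaces.

Variables (C : numFieldType) (d n : nat).

Local Notation N := (d.+1 + d.+1)%N.
Local Notation SVV := {mpoly C[N]}.
Local Notation Vn := (SVVn C d n).

Definition Hn (p : Vn) : Vn := DHomog (H_homog (dhomog_is_dhomog p)).

Lemma comm_D1n_D2n (p : Vn) : D1n (D2n p) = D2n (D1n p) + Hn p.
Proof. by apply/val_inj; rewrite /= -comm_D1_D2 addrC subrK. Qed.

Lemma comm_Hn_D1n (p : Vn) : Hn (D1n p) = D1n (Hn p) + 2%:R *: D1n p.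
Proof. by apply/val_inj; rewrite /= -comm_H_D1 addrC subrK. Qed.

Lemma comm_D2n_Hn (p : Vn) : D2n (Hn p) = Hn (D2n p) + 2%:R *: D2n p.
Proof. by apply/val_inj; rewrite /= -comm_D2_H addrC subrK. Qed.

(** [H] multiplies each coefficient by the weight of its monomial, so any monomial in the support of
    an eigenvector has the eigenvalue as its weight. *)
Lemma weight_bound (c : C) (p : Vn) : Hn p = c *: p ->
  p != 0 -> exists m : 'X_{1..N},
    mdeg m = n /\ c = (n * d)%:R - (2 * mindex m)%:R.
Proof.
move=> /(congr1 val) /= Hp p0.
have : (val p : SVV) != 0 by [].
rewrite -msupp_eq0; case E : (msupp (val p : SVV)) => [//|m s] _.
have mp : m \in msupp (val p : SVV) by rewrite E mem_head.
have degm : mdeg m = n := dhomog_mf (dhomog_is_dhomog p) mp.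
exists m; split=> //; move: (congr1 (mcoeff m) Hp).
rewrite mcoeff_H mcoeffZ degm => /mulIf <-; rewrite ?natrM 1?mulrC //.
by rewrite -mcoeff_msupp.
Qed.

Lemma mindex_le (m : 'X_{1..N}) : (mindex m <= d * mdeg m)%N.
Proof.
rewrite mdegE big_distrr; apply: leq_sum => i _; rewrite leq_mul2r.
by rewrite /vidx; case: split => j; rewrite -ltnS ltn_ord orbT.
Qed.

(** Weights in degree [n] are at most [n * d], which is the bound that [sl2_injective] asks for. *)
Lemma D1nD2n_inj (m c : nat) (p : Vn) : (0 < m)%N -> Hn p = m%:R *: p ->
  D1n (D2n p) + c%:R *: p = 0 -> p = 0.
Proof.
apply: (@sl2_injective C Vn (@D1n C d n) (@D2n C d n) Hn (n * d)).
- exact: comm_D1n_D2n.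
- exact: comm_Hn_D1n.
move=> x k ltk Hx; apply/eqP/negPn/negP => /(weight_bound Hx) [u [_ /eqP]].
by rewrite eq_sym subr_eq -natrD eqr_nat => /eqP E; move: ltk; rewrite E; lia.
Qed.

(** [D2], [D1], [- H] satisfy the same relations, and [mindex_le] bounds the weights below by
    [- (n * d)]. *)
Lemma D2nD1n_inj (m c : nat) (p : Vn) : (0 < m)%N -> Hn p = - (m%:R *: p) ->
  D2n (D1n p) + c%:R *: p = 0 -> p = 0.
Proof.
move=> m0 Hp; apply: (@sl2_injective C Vn (@D2n C d n) (@D1n C d n)
  (fun x => - Hn x) (n * d)) m0 _.
- by move=> x; rewrite /= comm_D1n_D2n addrK.
- by move=> x; rewrite /= linearN /= comm_D2n_Hn opprD subrK.
- move=> x k ltk /eqP; rewrite eqr_oppLR -scaleNr => /eqP Hx.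
  apply/eqP/negPn/negP => /(weight_bound Hx) [u [degu /eqP]].
  rewrite eq_sym subr_eq addrC eq_sym subr_eq -natrD eqr_nat => /eqP E.
  by have := mindex_le u; rewrite degu; lia.
- by rewrite Hp opprK.
Qed.

(* Exponent vectors of the monomials of degree n and weight w; the weight of
   v_i is d - 2i, and no exponent exceeds n. *)
Definition wset (w : nat) : {set {ffun 'I_N -> 'I_n.+1}} :=
  [set f : {ffun 'I_N -> 'I_n.+1} | (\sum_i f i == n)%N &
     (2 * (\sum_i vidx i * f i) + w == n * d)%N].

Definition mnm_ffun (f : {ffun 'I_N -> 'I_n.+1}) : 'X_{1..N} :=
  [multinom (f i : nat) | i < N].

Lemma mnm_ffun_inj : injective mnm_ffun.
Proof.
move=> f g /mnmP E; apply/ffunP => i; apply/val_inj.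
by have := E i; rewrite !mnmE.
Qed.

Lemma mdeg_mnm_ffun f : mdeg (mnm_ffun f) = (\sum_i f i)%N.
Proof. by rewrite mdegE; apply: eq_bigr => i _; rewrite mnmE. Qed.

Lemma mindex_mnm_ffun f : mindex (mnm_ffun f) = (\sum_i vidx i * f i)%N.
Proof. by apply: eq_bigr => i _; rewrite mnmE. Qed.

(** The default value of [insubd] never occurs, since members of [wset w] give monomials of degree
    [n]. *)
Definition wmonomials (w : nat) : #|wset w|.-tuple Vn :=
  [tuple insubd (0 : Vn) ('X_[mnm_ffun (enum_val i)] : SVV) | i < #|wset w|].

Lemma val_wmonomials w i :
  val ((wmonomials w)`_i) = if insub i is Some j
    then 'X_[mnm_ffun (@enum_val _ (mem (wset w)) j)] else 0 :> SVV.
Proof.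
case: insubP => [j ltj <-|]; last first.
  by rewrite -leqNgt => lei; rewrite nth_default ?size_tuple.
rewrite -tnth_nth tnth_mktuple val_insubd.
have := enum_valP j; rewrite inE => /andP[/eqP degf _].
by rewrite dhomogX /= mdeg_mnm_ffun degf eqxx.
Qed.

Lemma wmonomials_free w : free (wmonomials w).
Proof.
apply/freeP => k sum0 i.
have /(congr1 (mcoeff (mnm_ffun (enum_val i)) \o val)) /= := sum0.
rewrite raddf_sum /= raddf_sum /= mcoeff0.
rewrite (bigD1 i) //= big1 ?addr0 => [|j ji].
  by rewrite val_wmonomials valK mcoeffZ mcoeffX eqxx mulr1.
rewrite val_wmonomials valK mcoeffZ mcoeffX (inj_eq mnm_ffun_inj).
by rewrite (inj_eq enum_val_inj) (negPf ji) mulr0.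
Qed.

Definition wspace w : {vspace Vn} := <<wmonomials w>>%VS.

Lemma dim_wspace w : \dim (wspace w) = #|wset w|.
Proof. by have /eqP := wmonomials_free w; rewrite size_tuple. Qed.

(** No exponent exceeds the degree, so [inord] loses nothing. *)
Lemma wset_mnm w (m : 'X_{1..N}) :
  mdeg m = n -> (2 * mindex m + w = n * d)%N ->
  exists2 f, f \in wset w & mnm_ffun f = m.
Proof.
move=> degm wm.
have ltm i : (m i < n.+1)%N by rewrite ltnS -degm mdegE (bigD1 i) //= leq_addr.
have E : mnm_ffun [ffun i => inord (m i)] = m.
  by apply/mnmP => i; rewrite mnmE ffunE inordK.
exists [ffun i => inord (m i)] => //.
by rewrite inE -mdeg_mnm_ffun -mindex_mnm_ffun E degm wm !eqxx.
Qed.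

(** As [H] is diagonal on monomials, its eigenvectors are supported on monomials of one weight;
    characteristic 0 lets weights be compared as natural numbers. *)
Lemma mem_wspace w (p : Vn) : reflect (Hn p = w%:R *: p) (p \in wspace w).
Proof.
apply: (iffP idP) => [pw | Hp].
  apply/val_inj/mpolyP => m /=; rewrite mcoeff_H mcoeffZ.
  have [->|pm] := eqVneq (val p : SVV)@_m 0; first by rewrite !mulr0.
  suff [-> wm] : mdeg m = n /\ (2 * mindex m + w = n * d)%N.
    by rewrite -natrM mulnC -wm natrD addrAC subrr add0r.
  move: pm; rewrite (coord_span pw) raddf_sum /= raddf_sum /=.
  have [/existsP[i /eqP Em] _|] :=
      boolP [exists i, mnm_ffun (@enum_val _ (mem (wset w)) i) == m].
    have := enum_valP i; rewrite inE -mdeg_mnm_ffun -mindex_mnm_ffun Em.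
    by case/andP => /eqP-> /eqP->.
  rewrite negb_exists => /forallP nm; rewrite big1 ?eqxx // => i _.
  rewrite val_wmonomials valK mcoeffZ mcoeffX.
  by rewrite (negPf (nm i)) mulr0.
have -> : p = \sum_(m <- msupp (val p : SVV))
    (val p : SVV)@_m *: insubd (0 : Vn) ('X_[m] : SVV).
  apply/val_inj; rewrite /= {1}[mpoly_of_dhomog p]mpolyE raddf_sum /=.
  rewrite !big_seq; apply: eq_bigr => m mp; congr (_ *: _).
  rewrite -[RHS]/(val _) val_insubd dhomogX /=.
  by rewrite (dhomog_mf (dhomog_is_dhomog p) mp) eqxx.
rewrite big_seq; apply: memv_suml => m mp; apply/memvZ/memv_span.
have degm : mdeg m = n := dhomog_mf (dhomog_is_dhomog p) mp.
have wm : (2 * mindex m + w = n * d)%N.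
  move: (congr1 (mcoeff m \o val) Hp) => /=; rewrite mcoeff_H mcoeffZ.
  rewrite mcoeff_msupp in mp.
  move=> /(mulIf mp) /eqP; rewrite subr_eq addrC -natrD degm -natrM.
  by rewrite eqr_nat mulnC => /eqP ->.
have [f fw <-] := wset_mnm degm wm.
apply/mapP; exists (enum_rank_in fw f); first by rewrite mem_enum.
by rewrite enum_rankK_in.
Qed.

(** If [v] has weight 0 and [D1 v = 0], then [D2 v] has weight -2 and
    [D1 (D2 v) = D2 (D1 v) + H v = 0], so [D2nD1n_inj] gives [D2 v = 0]. *)
Lemma invariantsE :
  invariants C d n = (wspace 0 :&: lker (linfun (@D1n C d n)))%VS.
Proof.
apply/vspaceP => v; rewrite !memv_cap !memv_ker !lfunE /=.
apply/andP/andP => [[/eqP v1 /eqP v2]|[/mem_wspace v0 /eqP v1]].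
  split; last by apply/eqP.
  apply/mem_wspace; rewrite scale0r.
  have := comm_D1n_D2n v; rewrite v1 v2.
  by rewrite !linear0 add0r.
split; first exact/eqP.
apply/eqP/(@D2nD1n_inj 2 0) => //.
  have := comm_D2n_Hn v; rewrite v0 scale0r linear0.
  by move/esym/eqP; rewrite addr_eq0 => /eqP.
have := comm_D1n_D2n v; rewrite v0 v1 scale0r linear0 addr0 => ->.
by rewrite linear0 scale0r addr0.
Qed.

(** [D1 D2] is an injective endomorphism of the weight 2 space, hence onto by dimension; the image
    of [D2], inside weight 0, thus already covers weight 2 under [D1]. *)
Lemma limg_D1n : (linfun (@D1n C d n) @: wspace 0)%VS = wspace 2.
Proof.
have sub20 : (linfun (@D2n C d n) @: wspace 2 <= wspace 0)%VS.
  apply/subvP => _ /memv_imgP[v /mem_wspace v2 ->]; apply/mem_wspace.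
  have := comm_D2n_Hn v; rewrite v2 linearZ /= lfunE /= scale0r.
  by rewrite -[LHS]add0r => /addIr.
have sub02 : (linfun (@D1n C d n) @: wspace 0 <= wspace 2)%VS.
  apply/subvP => _ /memv_imgP[v /mem_wspace v0 ->]; apply/mem_wspace.
  by rewrite lfunE /= comm_Hn_D1n v0 scale0r linear0 add0r.
apply/eqP; rewrite eqEsubv sub02 /=.
have sub22 : (linfun (@D1n C d n) @: (linfun (@D2n C d n) @: wspace 2) <=
    wspace 2)%VS by apply: subv_trans sub02; apply: limgS.
suff /eqP <- : (linfun (@D1n C d n) @: (linfun (@D2n C d n) @: wspace 2) ==
    wspace 2)%VS by apply: limgS.
rewrite eqEdim sub22 -limg_comp limg_dim_eq ?leqnn //.
apply/eqP; rewrite -subv0; apply/subvP => v; rewrite memv_cap memv_ker memv0.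
rewrite !lfunE /= !lfunE /= => /andP[/mem_wspace v2 /eqP D12v].
by apply/eqP/(@D1nD2n_inj 2 0) => //; rewrite D12v scale0r addr0.
Qed.

(** Rank-nullity for [D1] on weight 0, in additive form to avoid truncated subtraction. *)
Lemma dim_invariants : (\dim (invariants C d n) + #|wset 2| = #|wset 0|)%N.
Proof.
by rewrite invariantsE -!dim_wspace -limg_D1n limg_ker_dim.
Qed.

End WeightSpaces.

(** * Partial fractions *)

Section PartialFractionExpansion.

Variables (K : fieldType) (D : nat) (x : 'I_D -> K).
Hypotheses (x_inj : injective x) (x_neq0 : forall k, x k != 0).

Let u k : {poly K} := 1 - x k *: 'X.

Lemma size_linear k : (size (u k) <= 2)%N.
Proof.
apply: leq_trans (size_polyD _ _) _; rewrite size_poly1 size_polyN geq_max /=.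
by apply: leq_trans (size_scale_leq _ _) _; rewrite size_polyX.
Qed.

(* [1 / prod_j (1 - x_j t)^2] is the sum over k of
   [pf_coef2 k / (1 - x_k t)^2 + pf_coef1 k / (1 - x_k t)]; both coefficients
   come from Hermite interpolation of 1 at the points [1 / x_k]. *)
Definition cofactor_sq k : {poly K} :=
  \prod_(j < D | j != k) (1 - x j *: 'X) ^+ 2.
Definition pf_coef2 k : K := (cofactor_sq k).[(x k)^-1]^-1.
Definition pf_coef1 k : K :=
  (x k)^-1 * (cofactor_sq k)^`().[(x k)^-1] / (cofactor_sq k).[(x k)^-1] ^+ 2.

Lemma cofactor_sq_neq0 k : (cofactor_sq k).[(x k)^-1] != 0.
Proof.
rewrite horner_prod; apply/prodf_neq0 => j jk.
rewrite horner_exp expf_neq0 // !hornerE subr_eq0 eq_sym.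
apply: contra jk => /eqP E; apply/eqP/x_inj.
by rewrite -[x j](mulfVK (x_neq0 k)) E mul1r.
Qed.

(** At [1 / x k] the factor [u k] vanishes with derivative [- x k]: [pf_coef2] normalises the value
    and [pf_coef1] cancels the derivative. *)
Lemma pf_numerator k : let a := (x k)^-1 in
  let t := ((pf_coef2 k)%:P + pf_coef1 k *: u k) * cofactor_sq k in
  t.[a] = 1 /\ t^`().[a] = 0.
Proof.
move=> a t; have q0 := cofactor_sq_neq0 k.
have ua : (u k).[a] = 0 by rewrite /u !hornerE mulfV ?subrr.
have du : (u k)^`().[a] = - x k.
  rewrite /u derivB -polyC1 derivC derivZ derivX sub0r.
  by rewrite hornerN hornerZ hornerC mulr1.
split; first by rewrite hornerM hornerD hornerZ ua hornerC mulr0 addr0 mulVf.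
rewrite derivM derivD derivC add0r derivZ hornerD !hornerM !hornerD !hornerZ.
rewrite ua du hornerC mulr0 addr0 /pf_coef1 /pf_coef2 -/a.
rewrite /a mulrN; field.
by rewrite x_neq0 q0.
Qed.

(** [cofactor_sq j] contains [u k ^+ 2], which has a double root at [1 / x k]. *)
Lemma pf_cross j k : j != k -> let a := (x k)^-1 in
  let t := ((pf_coef2 j)%:P + pf_coef1 j *: u j) * cofactor_sq j in
  t.[a] = 0 /\ t^`().[a] = 0.
Proof.
move=> jk a t; have ua : (u k).[a] = 0 by rewrite /u !hornerE mulfV ?subrr.
have -> : t = ((pf_coef2 j)%:P + pf_coef1 j *: u j) *
    (\prod_(i < D | (i != j) && (i != k)) (1 - x i *: 'X) ^+ 2) * u k * u k.
  rewrite /t /cofactor_sq (bigD1 k) 1?eq_sym //=.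
  by rewrite [X in _ * X]mulrC expr2 !mulrA.
split; first by rewrite hornerM ua mulr0.
by rewrite derivM hornerD !hornerM ua !(mulr0, mul0r) addr0.
Qed.

Lemma size_cofactor_sq k : (size (cofactor_sq k) <= 2 * D - 1)%N.
Proof.
have D_gt0 : (0 < D)%N by case: (D) k => [[]|].
apply: leq_trans (size_prod_leq _ _) _.
rewrite (eq_card (B := predC1 k)) // cardC1 card_ord.
(* Each of the [D - 1] squares has size at most 3, and [3(D - 1) + 1 - (D - 1) = 2D - 1]. *)
set S := (\sum_(j < D | _) _)%N; suff : (S <= D.-1 * 3)%N by lia.
rewrite -[D in D.-1]card_ord -(cardC1 k) -sum_nat_const; apply: leq_sum => j _.
apply: leq_trans (size_poly_exp_leq _ _) _.
by have := size_linear j; rewrite /u; case: size => [|[|[]]].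
Qed.

(** Divide [p] by the product of the ['X - a k]. The vanishing of the derivative makes the quotient
    vanish at every [a k] too; if nonzero it has size above [D], and [p] has size above [2 * D]. *)
Lemma poly_double_roots_eq0 (a : 'I_D -> K) (p : {poly K}) :
  injective a -> (size p <= 2 * D)%N ->
  (forall k, p.[a k] = 0 /\ p^`().[a k] = 0) -> p = 0.
Proof.
move=> a_inj szp pa; pose rs := [seq a k | k <- enum 'I_D].
have urs : uniq rs by rewrite map_inj_uniq ?enum_uniq.
have szrs : size rs = D by rewrite size_map size_enum_ord.
have [s Es] : exists s, p = s * \prod_(z <- rs) ('X - z%:P).
  apply: uniq_roots_prod_XsubC; last by rewrite uniq_rootsE.
  by apply/allP => _ /mapP[k _ ->]; apply/rootP; case: (pa k).
have Es' : p = s * \prod_(k < D) ('X - (a k)%:P).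
  by rewrite Es big_map big_enum.
have sa k : s.[a k] = 0.
  case: (pa k) => _; rewrite Es' (bigD1 k) //= mulrCA derivM derivXsubC mul1r.
  rewrite hornerD !hornerM hornerXsubC subrr mul0r addr0 => /eqP.
  rewrite mulf_eq0 => /orP[/eqP//|]; rewrite horner_prod => /prodf_eq0[j jk].
  by rewrite hornerXsubC subr_eq0 => /eqP/a_inj E; rewrite E eqxx in jk.
have [s0|s_neq0] := eqVneq s 0; first by rewrite Es s0 mul0r.
have lts : (D < size s)%N.
  rewrite -szrs; apply: max_poly_roots urs => //.
  by apply/allP => _ /mapP[k _ ->]; apply/rootP.
move: szp; rewrite Es size_Mmonic ?monic_prod_XsubC // size_prod_XsubC szrs.
by rewrite addnS /= mul2n -addnn leq_add2r leqNgt lts.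
Qed.

(** The difference of the two sides has size at most [2 * D] and a double root at each of the [D]
    points [1 / x k]. *)
Lemma partial_fraction : (0 < D)%N ->
  \sum_k ((pf_coef2 k)%:P + pf_coef1 k *: u k) * cofactor_sq k = 1.
Proof.
move=> D_gt0; apply/eqP; rewrite -subr_eq0; apply/eqP.
apply: (@poly_double_roots_eq0 (fun k => (x k)^-1)).
- by move=> i j /invr_inj/x_inj.
- apply: leq_trans (size_polyD _ _) _; rewrite size_polyN size_poly1 geq_max.
  apply/andP; split; last first.
    by rewrite muln_gt0.
  apply: leq_trans (size_sum _ _ _) _; apply/bigmax_leqP => k _.
  apply: leq_trans (size_polyMleq _ _) _.
  have : (size ((pf_coef2 k)%:P + pf_coef1 k *: u k)%R <= 2)%N.
    apply: leq_trans (size_polyD _ _) _; rewrite geq_max.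
    rewrite (leq_trans (size_polyC_leq1 _)) //=.
    by apply: leq_trans (size_scale_leq _ _) _; apply: size_linear.
  by have := size_cofactor_sq k; have := ltn_ord k; lia.
move=> k; rewrite (bigD1 k) //=.
set rest := \sum_(i < D | _) _.
have [r0 r1] : rest.[(x k)^-1] = 0 /\ rest^`().[(x k)^-1] = 0.
  rewrite raddf_sum /= !horner_sum.
  by split; apply: big1 => j /pf_cross [].
have [t0 t1] := pf_numerator k.
rewrite derivB derivD [1^`()]derivC.
rewrite [_.[_]]hornerD [X in _ /\ X = _]hornerD hornerD hornerN hornerD.
by rewrite r0 r1 t0 t1 hornerN !hornerC addr0 subrr oppr0 !addr0.
Qed.

(** * Truncated geometric series in [t] *)

Section Truncation.

Variable n : nat.

(** Congruence modulo ['X^n.+1], which lets polynomials stand for power series in [t]. *)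
Definition eq_trunc (p q : {poly K}) := forall i, (i <= n)%N -> p`_i = q`_i.

Lemma eq_truncM p q p' q' :
  eq_trunc p p' -> eq_trunc q q' -> eq_trunc (p * q) (p' * q').
Proof.
move=> Ep Eq i lein; rewrite !coefM; apply: eq_bigr => j _.
rewrite Ep ?Eq //; first by apply: leq_trans (leq_subr _ _) lein.
by apply: leq_trans lein; rewrite -ltnS.
Qed.

Definition geom_trunc (y : K) : {poly K} := \poly_(i < n.+1) y ^+ i.

Lemma geom_truncE y : eq_trunc ((1 - y *: 'X) * geom_trunc y) 1.
Proof.
move=> i lein; rewrite mulrBl mul1r -scalerAl coefB coefZ coefXM !coef_poly.
rewrite ltnS lein coef1; case: i lein => [|i] lein.
  by rewrite mulr0 subr0.
by rewrite /= ltnS ltnW // -exprS subrr.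
Qed.

Lemma geom_trunc_sq y : (geom_trunc y * geom_trunc y)`_n = y ^+ n *+ n.+1.
Proof.
rewrite coefM -[in RHS](card_ord n.+1) -sumr_const; apply: eq_bigr => j _.
have lejn : (j <= n)%N by rewrite -ltnS.
by rewrite !coef_poly !ltnS leq_subr lejn -exprD subnKC.
Qed.

(** Multiply the partial fraction identity by the product of squared geometric series; each summand
    then reduces to its own one or two series. *)
Lemma coef_prod_geom : (0 < D)%N ->
  (\prod_k (geom_trunc (x k) ^+ 2))`_n =
  \sum_k (pf_coef1 k + pf_coef2 k *+ n.+1) * x k ^+ n.
Proof.
move=> /partial_fraction pf.
rewrite -[\prod_k _]mul1r -[X in X * _]pf mulr_suml coef_sum.
apply: eq_bigr => k _; set g := geom_trunc (x k).
(* The cofactor cancels the series of all indices other than [k]. *)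
have Er : eq_trunc
    (cofactor_sq k * \prod_(j < D | j != k) geom_trunc (x j) ^+ 2) 1.
  rewrite -big_split /=; apply: (big_ind (fun p => eq_trunc p 1)) => //.
    by move=> p q Ep Eq i lein; rewrite -[1]mulr1; apply: eq_truncM.
  move=> j _ i lein; rewrite -exprMn expr2.
  by rewrite (eq_truncM (geom_truncE _) (geom_truncE _) lein) mulr1.
rewrite (bigD1 k) //= -/g.
transitivity (((((pf_coef2 k)%:P * (g * g)) + (pf_coef1 k)%:P * (u k * g * g)) *
   (cofactor_sq k * \prod_(j < D | j != k) geom_trunc (x j) ^+ 2))`_n).
  congr ((_ : {poly K})`_n); rewrite -mul_polyC; ring.
(* In the simple-pole term [u k] absorbs one of the two copies of [g]. *)
pose p' := (pf_coef2 k)%:P * (g * g) + (pf_coef1 k)%:P * g.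
rewrite (eq_truncM (p' := p') _ Er) //.
  rewrite mulr1 /p' coefD !coefCM geom_trunc_sq coef_poly ltnSn.
  by rewrite mulrDl addrC mulrnAr mulrnAl.
move=> i lein; rewrite !coefD; congr (_ + _); rewrite !coefCM; congr (_ * _).
rewrite -[g in RHS]mul1r; apply: eq_truncM lein => //; exact: geom_truncE.
Qed.

End Truncation.

End PartialFractionExpansion.

(** Distributing the product over the sums, [f] records the exponent picked in each factor. *)
Lemma coef_prod_geom_trunc (K : fieldType) (I : finType) (n : nat)
    (y : I -> K) :
  (\prod_i geom_trunc n (y i))`_n =
  \sum_(f : {ffun I -> 'I_n.+1} | (\sum_i (f i : nat))%N == n)
    \prod_i y i ^+ f i.
Proof.
under eq_bigr do rewrite /geom_trunc poly_def.
rewrite bigA_distr_bigA coef_sum [RHS]big_mkcond; apply: eq_bigr => f _ /=.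
have -> : \prod_i (y i ^+ f i *: 'X^(f i)) =
    (\prod_i y i ^+ f i) *: 'X^(\sum_i (f i : nat))%N :> {poly K}.
  by rewrite scaler_prod expr_sum.
by rewrite coefZ coefXn eq_sym; case: eqP; rewrite ?mulr1 ?mulr0.
Qed.

Lemma prod_log_deriv (K : fieldType) (I : finType) (P : pred I)
    (F : I -> {poly K}) (a : K) :
  (forall j, P j -> (F j).[a] != 0) ->
  (\prod_(j | P j) F j)^`().[a] / (\prod_(j | P j) F j).[a] =
  \sum_(j | P j) (F j)^`().[a] / (F j).[a].
Proof.
(* Logarithmic derivatives add only for nonvanishing factors, so nonvanishing is carried through the
   induction. *)
move=> F0; suff [] : (\prod_(j | P j) F j).[a] != 0 /\
  (\prod_(j | P j) F j)^`().[a] / (\prod_(j | P j) F j).[a] =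
  \sum_(j | P j) (F j)^`().[a] / (F j).[a] by [].
apply: (big_ind2 (fun p s => p.[a] != 0 /\ p^`().[a] / p.[a] = s)).
- by rewrite [1^`()]derivC horner0 mul0r hornerC oner_neq0.
- move=> p s q t [p0 <-] [q0 <-]; rewrite hornerM mulf_neq0 //; split=> //.
  by rewrite addf_div // derivM hornerD !hornerM [q^`().[a] * _]mulrC.
- by move=> j Pj; rewrite F0.
Qed.

Lemma pf_coef2E (K : fieldType) (D : nat) (x : 'I_D -> K) (k : 'I_D) :
  pf_coef2 x k = \prod_(j < D | j != k) (1 - x j / x k)^-1 ^+ 2.
Proof.
rewrite /pf_coef2 /cofactor_sq horner_prod -prodfV.
apply: eq_bigr => j _; rewrite horner_exp exprVn.
by rewrite hornerD hornerN hornerZ hornerX hornerC.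
Qed.

(** [pf_coef1] is [pf_coef2] times a logarithmic derivative; with [y = x j / x k] each squared
    factor contributes [- 2y / (1 - y) = 2(1 - 1 / (1 - y))]. Regularity at [z = 0] is read off this
    form. *)
Lemma pf_coef1E (K : fieldType) (D : nat) (x : 'I_D -> K) (k : 'I_D) :
  injective x -> (forall j, x j != 0) ->
  pf_coef1 x k =
    pf_coef2 x k * \sum_(j < D | j != k) (1 - (1 - x j / x k)^-1) *+ 2.
Proof.
move=> x_inj x0; have q0 := cofactor_sq_neq0 x_inj x0 k.
have u0 j : j != k -> (1 - x j *: 'X).[(x k)^-1] != 0.
  move=> jk; apply: contraNneq q0 => uj.
  by rewrite /cofactor_sq (bigD1 j) //= !hornerM uj !mul0r.
rewrite /pf_coef1 /pf_coef2; set q := cofactor_sq x k; set a := (x k)^-1.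
transitivity (q.[a]^-1 * (a * (q^`().[a] / q.[a]))).
  move: q0; rewrite -/q -/a.
  by move: (q.[a]) (q^`().[a]) (a) => y y' b y0; field.
congr (_ * _); rewrite prod_log_deriv => [|j jk]; last first.
  by rewrite horner_exp expf_neq0 ?u0.
rewrite mulr_sumr; apply: eq_bigr => j /u0; rewrite -/a.
have -> : (1 - x j *: 'X).[a] = 1 - x j / x k.
  by rewrite hornerD hornerN hornerZ hornerX hornerC.
move=> v0; rewrite expr2 derivM hornerD !hornerM.
have -> : (1 - x j *: 'X)^`().[a] = - x j.
  rewrite derivB [1^`()]derivC derivZ derivX sub0r.
  by rewrite hornerN hornerZ hornerC mulr1.
have -> : (1 - x j *: 'X).[a] = 1 - x j / x k.
  by rewrite hornerD hornerN hornerZ hornerX hornerC.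
have : x j = (1 - (1 - x j / x k)) * x k by rewrite subKr mulfVK.
move: v0; move: (1 - x j / x k) => v v0 ->; rewrite /a; field.
by rewrite v0 x0.
Qed.

(** * Taylor coefficients of rational functions *)

Section Taylor.

Variable C : numFieldType.

Local Notation ratfun := {fraction {poly C}}.
Local Notation "x %:F" := (@FracField.tofrac {poly C} x).

Implicit Types (r s : ratfun) (p q : {poly C}).

(** The fraction need not be reduced: [rlim_frac] evaluates any such representative. *)
Definition regular0 r := exists p q, q.[0] != 0 /\ r = p%:F / q%:F.

Lemma poly_horner_neq0 q : q.[0] != 0 -> q != 0.
Proof. by apply: contraNneq => ->; rewrite horner0. Qed.

Lemma tofrac_poly p : p%:F = p%:F / 1%:F.
Proof. by rewrite tofrac1 divr1. Qed.

Lemma regular0_poly p : regular0 p%:F.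
Proof. by exists p, 1; rewrite -tofrac_poly hornerC oner_neq0. Qed.

Lemma addf_frac p q p' q' : q != 0 -> q' != 0 ->
  p%:F / q%:F + p'%:F / q'%:F = (p * q' + p' * q)%:F / (q * q')%:F.
Proof.
by move=> q0 q'0; rewrite addf_div ?tofrac_eq0 // !(tofracD, tofracM).
Qed.

Lemma mulf_frac p q p' q' :
  p%:F / q%:F * (p'%:F / q'%:F) = (p * p')%:F / (q * q')%:F.
Proof. by rewrite mulf_div !tofracM. Qed.

Lemma regular0D r s : regular0 r -> regular0 s -> regular0 (r + s).
Proof.
move=> [p [q [q0 ->]]] [p' [q' [q'0 ->]]].
exists (p * q' + p' * q), (q * q'); rewrite hornerM mulf_neq0 //.
by rewrite addf_frac ?poly_horner_neq0.
Qed.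

Lemma regular0M r s : regular0 r -> regular0 s -> regular0 (r * s).
Proof.
move=> [p [q [q0 ->]]] [p' [q' [q'0 ->]]].
by exists (p * p'), (q * q'); rewrite hornerM mulf_neq0 // mulf_frac.
Qed.

Lemma rlim0D r s : regular0 r -> regular0 s ->
  rlim 0 (r + s) = rlim 0 r + rlim 0 s.
Proof.
move=> [p [q [q0 ->]]] [p' [q' [q'0 ->]]].
rewrite addf_frac ?poly_horner_neq0 // !rlim_frac ?hornerM ?mulf_neq0 //.
by rewrite hornerD !hornerM addf_div.
Qed.

Lemma rlim0M r s : regular0 r -> regular0 s ->
  rlim 0 (r * s) = rlim 0 r * rlim 0 s.
Proof.
move=> [p [q [q0 ->]]] [p' [q' [q'0 ->]]].
rewrite mulf_frac // !rlim_frac ?hornerM ?mulf_neq0 //.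
by rewrite mulf_div.
Qed.

Lemma rlim0_poly p : rlim 0 p%:F = p.[0].
Proof. by rewrite tofrac_poly rlim_frac hornerC ?oner_neq0 // divr1. Qed.

Lemma regular0V r : regular0 r -> rlim 0 r != 0 -> regular0 r^-1.
Proof.
move=> [p [q [q0 ->]]]; rewrite rlim_frac // mulf_eq0 negb_or => /andP[p0 _].
by exists q, p; rewrite invf_div.
Qed.

Lemma rderivD r s : rderiv (r + s) = rderiv r + rderiv s.
Proof.
rewrite (ratfun_repr r) (ratfun_repr s).
move: (denom_ratioP (repr r)) (denom_ratioP (repr s)).
move: (\n_(repr r)) (\d_(repr r)) (\n_(repr s)) (\d_(repr s)).
move=> p q p' q' q0 q'0; rewrite addf_frac // !rderiv_frac ?mulf_neq0 //.
rewrite addf_frac ?expf_neq0 //.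
apply/eqP; rewrite eqr_div ?tofrac_eq0 ?expf_neq0 ?mulf_neq0 ?expf_neq0 //.
rewrite -!tofracM tofrac_eq !derivE; apply/eqP.
ring.
Qed.

Lemma rderivM r s : rderiv (r * s) = rderiv r * s + r * rderiv s.
Proof.
rewrite (ratfun_repr r) (ratfun_repr s).
move: (denom_ratioP (repr r)) (denom_ratioP (repr s)).
move: (\n_(repr r)) (\d_(repr r)) (\n_(repr s)) (\d_(repr s)).
move=> p q p' q' q0 q'0; rewrite mulf_frac // !rderiv_frac ?mulf_neq0 //.
rewrite !mulf_frac addf_frac ?mulf_neq0 ?expf_neq0 //.
apply/eqP; rewrite eqr_div ?tofrac_eq0 ?expf_neq0 ?mulf_neq0 ?expf_neq0 //.
rewrite -!tofracM tofrac_eq !derivE; apply/eqP.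
ring.
Qed.

Lemma rderiv_poly p : rderiv p%:F = p^`()%:F.
Proof.
rewrite [p%:F]tofrac_poly rderiv_frac ?oner_neq0 // [1^`()]derivC.
by rewrite mulr0 subr0 mulr1 expr1n -tofrac_poly.
Qed.

Lemma regular0_rderiv r : regular0 r -> regular0 (rderiv r).
Proof.
move=> [p [q [q0 ->]]]; rewrite rderiv_frac ?poly_horner_neq0 //.
by exists (p^`() * q - p * q^`()), (q ^+ 2); rewrite horner_exp expf_neq0.
Qed.

Lemma regular0_iter n r : regular0 r -> regular0 (iter n (@rderiv C) r).
Proof. by move=> rr; elim: n => //= n; apply: regular0_rderiv. Qed.

Lemma iter_rderivD n r s :
  iter n (@rderiv C) (r + s) = iter n (@rderiv C) r + iter n (@rderiv C) s.
Proof. by elim: n => //= n ->; rewrite rderivD. Qed.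

Lemma taylorD r s i : regular0 r -> regular0 s ->
  taylor (r + s) i = taylor r i + taylor s i.
Proof.
by move=> rr rs; rewrite /taylor iter_rderivD rlim0D ?mulrDl //;
  apply: regular0_iter.
Qed.

Lemma regular0_sum (I : Type) (l : seq I) (P : pred I) (F : I -> ratfun) :
  (forall k, P k -> regular0 (F k)) -> regular0 (\sum_(k <- l | P k) F k).
Proof.
move=> rF; apply: big_ind => //; last by apply: regular0D.
by rewrite -tofrac0; apply: regular0_poly.
Qed.

Lemma taylorZ c r i : regular0 r -> taylor (c%:P%:F * r) i = c * taylor r i.
Proof.
move=> rr; rewrite /taylor mulrA; congr (_ / _).
have -> : iter i (@rderiv C) (c%:P%:F * r) = c%:P%:F * iter i (@rderiv C) r.
  elim: i => //= i ->; rewrite rderivM rderiv_poly derivC tofrac0 mul0r.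
  by rewrite add0r.
rewrite rlim0M ?rlim0_poly ?hornerC //; first exact: regular0_poly.
exact: regular0_iter.
Qed.

Lemma taylor0 i : taylor (0 : ratfun) i = 0.
Proof.
rewrite -[0 in LHS](mul0r (0 : ratfun)) -[0 in X in X * _]tofrac0 -polyC0.
by rewrite taylorZ ?mul0r // -tofrac0; apply: regular0_poly.
Qed.

Lemma taylor_sum (I : Type) (l : seq I) (P : pred I) (F : I -> ratfun) i :
  (forall k, P k -> regular0 (F k)) ->
  taylor (\sum_(k <- l | P k) F k) i = \sum_(k <- l | P k) taylor (F k) i.
Proof.
move=> rF; elim: l => [|k l IHl]; first by rewrite !big_nil taylor0.
rewrite !big_cons; case: ifP => // Pk.
by rewrite taylorD ?IHl //; [exact: rF | exact: regular0_sum].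
Qed.

(** Higher Leibniz rule, with two terms because the second derivative of [z] is zero; at [n = 0] the
    truncated [n.-1] is harmless, its multiplicity being 0. *)
Lemma iter_rderiv_mulX n r : iter n (@rderiv C) (zvar C * r) =
  zvar C * iter n (@rderiv C) r + iter n.-1 (@rderiv C) r *+ n.
Proof.
elim: n => [|n IHn]; first by rewrite addr0.
rewrite [LHS]iterS IHn rderivD rderivM rderiv_poly derivX tofrac1 mul1r.
have rderivMn s k : rderiv (s *+ k) = rderiv s *+ k.
  elim: k => [|k IHk]; last by rewrite !mulrS rderivD IHk.
  by rewrite !mulr0n -tofrac0 rderiv_poly deriv0.
rewrite rderivMn -iterS addrAC addrC; congr (_ + _).
by case: n {IHn} => [|n]; rewrite ?addr0 // -iterS -mulrS.
Qed.

Lemma rlim0Mn r n : regular0 r ->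
  regular0 (r *+ n) /\ rlim 0 (r *+ n) = rlim 0 r *+ n.
Proof.
move=> rr; elim: n => [|n [rn En]].
  rewrite !mulr0n -tofrac0 rlim0_poly horner0.
  by split=> //; apply: regular0_poly.
by rewrite !mulrS rlim0D // En; split=> //; apply: regular0D.
Qed.

(** At 0 only the second Leibniz term survives, and [i / i! = 1 / (i - 1)!] for positive [i]. *)
Lemma taylor_mulX r i : regular0 r -> taylor (zvar C * r) i = mulz (taylor r) i.
Proof.
move=> rr; have rX : regular0 (zvar C) by apply: regular0_poly.
have ri n := regular0_iter n rr.
have [rMn En] := rlim0Mn i (ri i.-1).
rewrite /taylor iter_rderiv_mulX rlim0D //; last exact: regular0M.
rewrite rlim0M // rlim0_poly hornerX mul0r add0r En.
case: i {rMn En} => [|i] /=; first by rewrite mulr0n mul0r.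
rewrite factS natrM -[rlim _ _ *+ _]mulr_natl -mulf_div divff ?mul1r //.
by rewrite pnatr_eq0.
Qed.

Lemma regular0_mulXn m r : regular0 r -> regular0 (zvar C ^+ m * r).
Proof.
by move=> rr; rewrite -tofracXn; apply: regular0M => //; apply: regular0_poly.
Qed.

Lemma taylor_mulXn m r i : regular0 r ->
  taylor (zvar C ^+ m * r) i = if (m <= i)%N then taylor r (i - m) else 0.
Proof.
move=> rr; elim: m i => [|m IHm] i; first by rewrite expr0 mul1r subn0.
rewrite exprS -mulrA taylor_mulX; last exact: regular0_mulXn.
by case: i => //= i; rewrite IHm ltnS subSS.
Qed.

Lemma taylorC c i : taylor c%:P%:F i = if i is 0 then c else 0.
Proof.
rewrite /taylor; case: i => [|i]; first by rewrite rlim0_poly hornerC divr1.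
rewrite iterSr rderiv_poly derivC.
have -> : iter i (@rderiv C) 0%:F = 0%:F.
  by elim: i => //= i ->; rewrite rderiv_poly deriv0.
by rewrite rlim0_poly horner0 mul0r.
Qed.

Lemma taylor_poly p i : taylor p%:F i = p`_i.
Proof.
elim/poly_ind: p i => [|p c IHp] i; first by rewrite tofrac0 taylor0 coef0.
have rX : regular0 (zvar C * p%:F).
  by apply: regular0M; apply: regular0_poly.
rewrite mulrC tofracD tofracM taylorD //; last exact: regular0_poly.
rewrite taylor_mulX; last exact: regular0_poly.
rewrite taylorC coefD coefXM coefC.
by case: i => [|i] //=; rewrite IHp.
Qed.

End Taylor.

(** * The coefficients A_k and B_k *)

(** Reversing the product replaces [j] by [d - j], and [d + (d - 2(d - j)) = 2j]. *)
Lemma f_ddE (L : fieldType) (d : nat) (t z : L) : z != 0 ->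
  f_dd d (t * z ^+ d) z = \prod_(0 <= j < d.+1) (1 - t * z ^+ (2 * j)) ^- 2.
Proof.
move=> z0; rewrite /f_dd big_nat_rev /= add0n; apply: eq_big_nat => j /=.
rewrite ltnS => lejd; congr ((1 - _) ^- 2).
rewrite -mulrA (exprnP z d) -expfzDr // (exprnP z (2 * j)); congr (_ * z ^ _).
by rewrite subSS; lia.
Qed.

Lemma prod_cancel_sq (L : fieldType) (D : nat) (F : nat -> L) (k : 'I_D) :
  F k != 0 ->
  (\prod_(0 <= j < D) F j ^- 2) * F k ^+ 2 =
  (\prod_(j < D | j != k) F j ^+ 2)^-1.
Proof.
move=> F0; rewrite big_mkord (bigD1 k) //= mulrAC mulVf ?expf_neq0 // mul1r.
by rewrite -prodfV.
Qed.

(** The double pole is cancelled explicitly, leaving the reciprocal of a polynomial in [t] on which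
    [rlim] is plain evaluation. *)
Lemma G_k_fraction (K : fieldType) (z : K) (d : nat) (k : 'I_d.+1) :
  let t := FracField.tofrac ('X : {poly K}) in
  let zz := FracField.tofrac z%:P in
  z != 0 ->
  f_dd d (t * zz ^+ d) zz * (1 - t * zz ^+ (2 * k)) ^+ 2 =
  FracField.tofrac 1 /
    FracField.tofrac (cofactor_sq (fun j : 'I_d.+1 => z ^+ (2 * j)) k).
Proof.
move=> t zz z0.
have uE j : 1 - t * zz ^+ (2 * j) = FracField.tofrac (1 - z ^+ (2 * j) *: 'X).
  by rewrite tofracB tofrac1 -mul_polyC mulrC tofracM polyC_exp tofracXn.
rewrite f_ddE ?tofrac_eq0 ?polyC_eq0 //.
rewrite (prod_cancel_sq (F := fun j => 1 - t * zz ^+ (2 * j))).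
  rewrite tofrac1 div1r /cofactor_sq; congr (_^-1).
  by rewrite rmorph_prod; apply: eq_bigr => j _; rewrite uE -tofracXn.
(* The cancelled factor is nonzero because it equals 1 at [t = 0]. *)
rewrite uE tofrac_eq0; apply/eqP => /(congr1 (fun p => p.[0])).
rewrite hornerD hornerN hornerZ hornerX mulr0 subr0 hornerC horner0.
by move/eqP; rewrite oner_eq0.
Qed.

Lemma rlim_inv_poly (K : fieldType) (a : K) (q : {poly K}) : q.[a] != 0 ->
  rlim a (FracField.tofrac 1 / FracField.tofrac q) = q.[a]^-1.
Proof. by move=> qa; rewrite rlim_frac // hornerC div1r. Qed.

Lemma rlim_rderiv_inv_poly (K : fieldType) (a : K) (q : {poly K}) :
  q.[a] != 0 ->
  rlim a (rderiv (FracField.tofrac 1 / FracField.tofrac q)) =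
  - (q^`().[a] / q.[a] ^+ 2).
Proof.
move=> qa; rewrite rderiv_frac; last first.
  by apply: contraNneq qa => ->; rewrite horner0.
rewrite rlim_frac horner_exp ?expf_neq0 // [1^`()]derivC.
by rewrite mul0r mul1r sub0r hornerN mulNr.
Qed.

Lemma inv_one_sub_inv (L : fieldType) (y : L) : y != 0 -> 1 - y != 0 ->
  (1 - y^-1)^-1 = y * (- (1 - y)^-1).
Proof.
move=> y0 y1; rewrite -[X in X - y^-1](divff y0) -mulN1r -mulrDl invfM invrK.
have -> : y + -1 = - (1 - y) by rewrite opprB.
by rewrite invrN mulrC.
Qed.

Lemma mulNrN_assoc (A : pzRingType) (a b c : A) : - a * - (b * c) = a * b * c.
Proof. by rewrite mulrNN mulrA. Qed.

Section Coefficients.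

Variables (C : numFieldType) (d : nat).

Local Notation ratfun := {fraction {poly C}}.
Local Notation z := (zvar C).

Lemma zvar_neq0 : z != 0.
Proof. by rewrite tofrac_eq0 polyX_eq0. Qed.

Definition zpow (k : 'I_d.+1) : ratfun := z ^+ (2 * k).

Lemma zpow_neq0 k : zpow k != 0.
Proof. by rewrite expf_neq0 ?zvar_neq0. Qed.

Lemma zpow_inj : injective zpow.
Proof.
move=> i j /eqP; rewrite /zpow -!tofracXn tofrac_eq => /eqP.
move=> /(congr1 (fun p : {poly C} => size p)) /eqP; rewrite !size_polyXn eqSS.
by rewrite eqn_pmul2l // => /eqP/val_inj.
Qed.

Lemma G_kE (k : 'I_d.+1) :
  G_k C d k = FracField.tofrac 1 / FracField.tofrac (cofactor_sq zpow k).
Proof.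
exact: G_k_fraction zvar_neq0.
Qed.

Lemma B_kE (k : 'I_d.+1) : B_k C d k = pf_coef2 zpow k.
Proof.
rewrite /B_k G_kE; apply: rlim_inv_poly.
exact: cofactor_sq_neq0 zpow_inj zpow_neq0 k.
Qed.

(** The minus sign in [A_k] compensates the one in the derivative [- q' / q^2] of [1 / q]. *)
Lemma A_kE (k : 'I_d.+1) : A_k C d k = pf_coef1 zpow k.
Proof.
rewrite /A_k G_kE.
rewrite (rlim_rderiv_inv_poly (cofactor_sq_neq0 zpow_inj zpow_neq0 k)).
exact: mulNrN_assoc.
Qed.

Lemma regular0_one_sub_zpow m : (0 < m)%N ->
  regular0 (1 - z ^+ m) /\ rlim 0 (1 - z ^+ m) = 1.
Proof.
move=> m0; have -> : 1 - z ^+ m = FracField.tofrac (1 - 'X^m).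
  by rewrite tofracB tofrac1 tofracXn.
split; first exact: regular0_poly.
rewrite rlim0_poly hornerD hornerN hornerXn hornerC expr0n.
by rewrite eqn0Ngt m0 subr0.
Qed.

Lemma regular0_inv_one_sub_zpow m : (0 < m)%N -> regular0 (1 - z ^+ m)^-1.
Proof.
move=> /regular0_one_sub_zpow[rz Ez].
by apply: regular0V => //; rewrite Ez oner_neq0.
Qed.

Lemma one_sub_zpow_neq0 m : (0 < m)%N -> 1 - z ^+ m != 0.
Proof.
move=> /regular0_one_sub_zpow[_ Ez]; apply: contra_eq_neq Ez => ->.
by rewrite -tofrac0 rlim0_poly horner0 eq_sym oner_neq0.
Qed.

Lemma regular0N (r : ratfun) : regular0 r -> regular0 (- r).
Proof.
move=> rr; have -> : - r = FracField.tofrac (-1%:P) * r.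
  by rewrite tofracN tofrac1 mulN1r.
by apply: regular0M => //; apply: regular0_poly.
Qed.

Lemma zpow_ratio (j k : 'I_d.+1) : (k <= j)%N ->
  zpow j / zpow k = z ^+ (2 * j - 2 * k).
Proof.
move=> lekj; have {1}-> : zpow j = z ^+ (2 * j - 2 * k) * zpow k.
  by rewrite -exprD subnK // leq_mul2l lekj.
by rewrite mulfK ?zpow_neq0.
Qed.

(* For [j < k] the factor is [1 / (1 - z^(-2m)) = - z^(2m) / (1 - z^(2m))]
   with [m = k - j]; hence the zero at [z = 0]. *)
Lemma regular0_pole (j k : 'I_d.+1) : j != k ->
  regular0 (1 - zpow j / zpow k)^-1 /\
  ((j < k)%N -> rlim 0 (1 - zpow j / zpow k)^-1 = 0).
Proof.
move=> jk; have : (j : nat) != k by [].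
rewrite neq_ltn => /orP[ltjk|ltkj]; last first.
  split; last by move=> ltjk; have := ltn_trans ltjk ltkj; rewrite ltnn.
  rewrite zpow_ratio ?(ltnW ltkj) //; apply: regular0_inv_one_sub_zpow.
  by rewrite -mulnBr muln_gt0 subn_gt0.
have m0 : (0 < 2 * k - 2 * j)%N by rewrite -mulnBr muln_gt0 subn_gt0.
rewrite -[zpow j / _]invrK invf_div zpow_ratio ?(ltnW ltjk) //.
rewrite (inv_one_sub_inv (expf_neq0 _ zvar_neq0) (one_sub_zpow_neq0 m0)).
have rN := regular0N (regular0_inv_one_sub_zpow m0).
split; first exact: regular0_mulXn.
move=> _; have rX : regular0 (z ^+ (2 * k - 2 * j)).
  by rewrite -tofracXn; apply: regular0_poly.
rewrite rlim0M // -tofracXn rlim0_poly hornerXn expr0n.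
by rewrite eqn0Ngt m0 mul0r.
Qed.

(** Every factor is regular, and for [k > 0] the factor of index 0 already vanishes at [z = 0]. *)
Lemma regular0_pf_coef2 (k : 'I_d.+1) :
  regular0 (pf_coef2 zpow k) /\ ((0 < k)%N -> rlim 0 (pf_coef2 zpow k) = 0).
Proof.
have rsq (r : ratfun) : regular0 r -> regular0 (r ^+ 2).
  by move=> rr; rewrite expr2; apply: regular0M.
have r1 : regular0 (1 : ratfun) by rewrite -tofrac1; apply: regular0_poly.
rewrite pf_coef2E; split.
  apply: big_ind => [//|r s|j jk]; first exact: regular0M.
  by apply: rsq; case: (regular0_pole jk).
move=> k0; have j0 : ord0 != k :> 'I_d.+1 by rewrite -val_eqE /= neq_ltn k0.
rewrite (bigD1 ord0) //=; have [r0 /(_ k0) E0] := regular0_pole j0.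
rewrite rlim0M; [|exact: rsq|].
  by rewrite expr2 rlim0M // E0 !mul0r.
apply: big_ind => [//|r s|j /andP[jk _]]; first exact: regular0M.
by apply: rsq; case: (regular0_pole jk).
Qed.

Lemma regular0_pf_coef1 (k : 'I_d.+1) :
  regular0 (pf_coef1 zpow k) /\ ((0 < k)%N -> rlim 0 (pf_coef1 zpow k) = 0).
Proof.
have [r2 E2] := regular0_pf_coef2 k.
rewrite (pf_coef1E k zpow_inj zpow_neq0).
set s := \sum_(j < _ | _) _; suff rs : regular0 s.
  split; first exact: regular0M.
  by move=> k0; rewrite rlim0M // E2 // mul0r.
apply: regular0_sum => j jk; have [r0 _] := regular0_pole jk.
have r1 : regular0 (1 : ratfun) by rewrite -tofrac1; apply: regular0_poly.
have rN := regular0N r0.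
by rewrite mulr2n; apply: regular0D; apply: regular0D.
Qed.

End Coefficients.

(** * Counting monomials by weight *)

Section Counting.

Variables (C : numFieldType) (d n : nat).

Local Notation z := (zvar C).
Local Notation N := (d.+1 + d.+1)%N.

(** The coefficient of [t^n] in [f(t z^d, z)]: a monomial of weight [w] contributes
    [z^(n d - w)]. *)
Definition weight_poly : {poly C} :=
  \sum_(f : {ffun 'I_N -> 'I_n.+1} | (\sum_i (f i : nat))%N == n)
    'X^(2 * (\sum_i vidx i * f i))%N.

(** Weights 0 and 2 correspond to exponents [n * d] and [n * d - 2], and the factor [1 - 'X^2] forms
    the difference of the two counts. *)
Lemma natr_dim_invariants :
  poincare C d n = ((1 - 'X^2) * weight_poly)`_(n * d).
Proof.
have cardE w : #|wset d n w|%:R =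
    \sum_(f : {ffun 'I_N -> 'I_n.+1} | (\sum_i (f i : nat))%N == n)
      (n * d == 2 * (\sum_i vidx i * f i) + w)%N%:R :> C.
  rewrite -sum1_card natr_sum [RHS]big_mkcond [LHS]big_mkcond.
  apply: eq_bigr => f _; rewrite inE eq_sym.
  by case: eqP => //= _; rewrite eq_sym; case: eqP.
have -> : poincare C d n = #|wset d n 0|%:R - #|wset d n 2|%:R.
  by rewrite -(dim_invariants C) natrD addrK.
rewrite !cardE -sumrB mulr_sumr coef_sum; apply: eq_bigr => f _.
by rewrite mulrBl mul1r -exprD coefB !coefXn addn0 addnC.
Qed.

Lemma weight_polyE : FracField.tofrac weight_poly =
  \sum_(k < d.+1) (A_k C d k + B_k C d k *+ n.+1) * z ^+ (2 * k * n).
Proof.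
transitivity (\sum_(k < d.+1) (pf_coef1 (@zpow C d) k +
    pf_coef2 (@zpow C d) k *+ n.+1) * zpow C k ^+ n); last first.
  by apply: eq_bigr => k _; rewrite A_kE B_kE exprM.
rewrite -coef_prod_geom //; [|exact: zpow_inj|exact: zpow_neq0].
(* The two copies of [V_d] have the same weights, whence the squares. *)
have -> : \prod_(k < d.+1) geom_trunc n (zpow C k) ^+ 2 =
    \prod_(i < N) geom_trunc n (z ^+ (2 * vidx i)).
  rewrite big_split_ord /= -big_split; apply: eq_bigr => j _.
  by rewrite expr2 vidx_lshift vidx_rshift.
rewrite coef_prod_geom_trunc rmorph_sum; apply: eq_bigr => f _ /=.
rewrite tofracXn big_distrr /= expr_sum; apply: eq_bigr => i _.
by rewrite mulnA exprM.
Qed.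

End Counting.

(** * Extraction of the Poincaré coefficients *)

Section PoincareFormula.

Variables (C : numFieldType) (d : nat).

Local Notation z := (zvar C).

Lemma regular0_coefs (k : 'I_d.+1) :
  [/\ regular0 ((1 - z ^+ 2) * A_k C d k), regular0 ((1 - z ^+ 2) * B_k C d k),
    (0 < k)%N -> taylor ((1 - z ^+ 2) * A_k C d k) 0 = 0 &
    (0 < k)%N -> taylor ((1 - z ^+ 2) * B_k C d k) 0 = 0].
Proof.
have [rz Ez] := regular0_one_sub_zpow C (isT : (0 < 2)%N).
have [r1 E1] := regular0_pf_coef1 C k.
have [r2 E2] := regular0_pf_coef2 C k.
rewrite A_kE B_kE; split; try exact: regular0M.
  by move=> /E1 E; rewrite /taylor /= rlim0M // E mulr0 mul0r.
by move=> /E2 E; rewrite /taylor /= rlim0M // E mulr0 mul0r.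
Qed.

(** The power [z^(2kn)] shifts the index [n d] to [n (d - 2k)], which [phi] reads off; [derivz]
    after [mulz] supplies the factor [n + 1]. *)
Lemma taylor_term (k : 'I_d.+1) (n : nat) :
  let r := (1 - z ^+ 2) *
    ((A_k C d k + B_k C d k *+ n.+1) * z ^+ (2 * k * n)) in
  regular0 r /\
  taylor r (n * d) = if (k <= d./2)%N then
    phi (d - 2 * k) (taylor ((1 - z ^+ 2) * A_k C d k)) n +
    derivz (mulz (phi (d - 2 * k) (taylor ((1 - z ^+ 2) * B_k C d k)))) n
  else 0.
Proof.
have [rA rB A0 B0] := regular0_coefs k.
have -> : (1 - z ^+ 2) * ((A_k C d k + B_k C d k *+ n.+1) * z ^+ (2 * k * n)) =
    z ^+ (2 * k * n) * ((1 - z ^+ 2) * A_k C d k +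
      FracField.tofrac n.+1%:R%:P * ((1 - z ^+ 2) * B_k C d k)).
  rewrite mulrA mulrC mulrDr; congr (_ * (_ + _)).
  by rewrite mulrnAr polyCMn tofracMn tofrac1 mulr_natl.
move: rA rB A0 B0; move: (_ * A_k C d k) (_ * B_k C d k) => a b rA rB A0 B0.
have rc : regular0 (FracField.tofrac n.+1%:R%:P * b).
  by apply: regular0M rB; apply: regular0_poly.
have rD := regular0D rA rc; split; first exact: regular0_mulXn rD.
rewrite (taylor_mulXn _ _ rD) (taylorD _ rA rc) (taylorZ _ _ rB).
rewrite /derivz /= /phi mulnBr [(2 * k * n)%N]mulnC.
(* For [n > 0] the shift leaves nothing when [2k > d]. For [n = 0] there is no shift, and the terms
   with [k > d / 2] vanish because [A_k] and [B_k] are 0 at [z = 0]. *)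
have [n0|n_gt0] := posnP n; last first.
  rewrite leq_pmul2l // mulr_natl.
  by have -> : (2 * k <= d)%N = (k <= d./2)%N by lia.
rewrite n0 !mul0n leqnn subn0 mulr1n mul1r.
case: ifPn => //; rewrite -ltnNge => ltk.
by rewrite A0 ?B0 ?addr0 //; apply: leq_ltn_trans ltk.
Qed.

Lemma poincare_formula (n : nat) :
  poincare C d n =
    \sum_(0 <= k < d./2.+1)
      phi (d - 2 * k) (taylor ((1 - z ^+ 2) * A_k C d k)) n +
    \sum_(0 <= k < d./2.+1)
      derivz (mulz (phi (d - 2 * k) (taylor ((1 - z ^+ 2) * B_k C d k)))) n.
Proof.
rewrite natr_dim_invariants -taylor_poly tofracM weight_polyE.
rewrite tofracB tofrac1 tofracXn -/(zvar C) mulr_sumr.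
rewrite taylor_sum => [|k _]; last by case: (taylor_term k n).
under eq_bigr => k _ do rewrite (taylor_term k n).2.
rewrite -(big_mkord xpredT (fun k => if (k <= d./2)%N then
    phi (d - 2 * k) (taylor ((1 - z ^+ 2) * A_k C d k)) n +
    derivz (mulz (phi (d - 2 * k) (taylor ((1 - z ^+ 2) * B_k C d k)))) n
  else 0)).
have led : (d./2.+1 <= d.+1)%N by lia.
rewrite (big_cat_nat (leq0n _) led) //= [X in _ + X]big1_seq ?addr0; last first.
  by move=> k /=; rewrite mem_index_iota => /andP[ltk _]; rewrite leqNgt ltk.
by rewrite -big_split; apply: eq_big_nat => k /=; rewrite ltnS => ->.
Qed.

End PoincareFormula.

Theorem theorem5 (R : realType) (d : nat) (hd : (0 < d)%N) :
  (let z := Cz_to_Czt (zvar R[i]) in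
   let t := tvar R[i] in
   f_dd d (t * z ^+ d) z =
     \prod_(0 <= j < d.+1) (1 - t * z ^+ (2 * j)) ^- 2) /\
  (let z := zvar R[i] in
   let A := A_k R[i] d in
   let B := B_k R[i] d in
   forall n : nat,
     poincare R[i] d n =
       \sum_(0 <= k < d./2.+1)
         phi (d - 2 * k) (taylor ((1 - z ^+ 2) * A k)) n +
       \sum_(0 <= k < d./2.+1)
         derivz (mulz (phi (d - 2 * k) (taylor ((1 - z ^+ 2) * B k)))) n).
Proof.
split=> [z t | z A B n]; last exact: poincare_formula.
by apply: f_ddE; rewrite tofrac_eq0 polyC_eq0 zvar_neq0.
Qed.
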